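(* Let $t=2s+\delta$ and $v=s+\alpha$, where $\delta\in\{0,1\}$ and $\alpha\geq 3$ is a fixed integer constant, and let $r=2\alpha-\delta-2$. For each constant $\tau\geq \frac{2r}{\ln r-\ln(r-2)}$, there exists an $(N,v,t)$-suitable core with $N=v(t+1-v)+\tau\ln s$ for all sufficiently large $s$.
   Context: Let $v,N,t$ be positive integers and $[v]=\{1,\dots,v\}$. An $N\times v$ array $C$ whose rows are permutations of $[v]$ is an $(N,v,t)$-suitable core if the following holds: choose $N$ new distinct symbols, prepend a different one of them to each row of $C$, and append the remaining $N-1$ new symbols (in arbitrary order) to that row; the resulting $N\times(v+N)$ array has the property that for every $t$-element subset $S$ of the $v+N$ symbols and every $\sigma\in S$ there is a row in which $\sigma$ occurs before every element of $S\setminus\{\sigma\}$. (Equivalently: for every symbol $\sigma\in[v]$ and every subset $T\subseteq[v]\setminus\{\sigma\}$, the number of rows of $C$ in which $\sigma$ precedes every element of $[v]\setminus(T\cup\{\sigma\})$ is at least $t+1-v+|T|$.) The paper tacitly treats quantities such as $\tau\ln s$ as integers. *)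

(* Defs.v *)
From mathcomp Require Import all_boot all_fingroup.

Set Implicit Arguments.
Unset Strict Implicit.
Unset Printing Implicit Defensive.

(* Rows are listings of the whole symbol type X, so [index x (A i)] is the
   position of the symbol x in row i. *)
Definition suitable_array (X : finType) (N t : nat) (A : 'I_N -> seq X) : Prop :=
  forall S : {set X}, #|S| = t -> forall x, x \in S ->
    exists i : 'I_N, forall y, y \in S :\ x -> index x (A i) < index y (A i).

(* The symbols of [v] are encoded as [inl] of 'I_v, and the N new symbols as
   [inr] of 'I_N.  The entry in column j of row i of C is [C i j]. *)
Definition core_extension (N v : nat) (C : 'I_N -> 'S_v)
    (A : 'I_N -> seq ('I_v + 'I_N)) : Prop :=
  exists (first : 'I_N -> 'I_N) (rest : 'I_N -> seq 'I_N),
    [/\ injective first,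
        forall i, perm_eq (rest i) [seq k <- enum 'I_N | k != first i] &
        forall i, A i = inr (first i) ::
                        [seq inl (C i j) | j <- enum 'I_v] ++
                        [seq inr k | k <- rest i]].

(* The new symbols may be distributed and ordered arbitrarily, hence the
   universal quantification over extensions (at least one always exists). *)
Definition suitable_core (N v t : nat) (C : 'I_N -> 'S_v) : Prop :=
  forall A, core_extension C A -> suitable_array t A.

(* Main.v *)
(** Let k = t + 1 - v, so that v = k + 1 + r.  Single out r symbols (colours)
   and let n = k + 1 be the number of the others (points).  Every ordered pair
   of distinct points x, x' starts one row, followed there by a colour g x x';
   every colour starts k + e rows with e = floor(m / r), whose second symbols
   cover all other symbols.  A point then meets the suitability condition
   exactly, while a colour b has e rows to spare and meets it as soon as every
   set of e + 1 points contains a pair x, x' with g x x' = b.  A random g with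
   g x' x = g x x' + 1 has this property with positive probability once
   r C(n, e+1) ((r-2)/r)^C(e+1, 2) < 1, as in Erdos' bound for Ramsey numbers,
   and this holds since e + 1 > 2 ln s / (ln r - ln (r - 2)). *)
Require Import Defs.
From mathcomp Require Import all_boot all_order all_algebra all_fingroup.
From mathcomp Require Import reals exp.
From mathcomp Require Import sequences zify lra.
Import Order.TTheory GRing.Theory Num.Theory.

Set Implicit Arguments.
Unset Strict Implicit.
Unset Printing Implicit Defensive.

(** * Reduction of suitability to prefixes of rows *)

Definition before (v : nat) (c : 'S_v) (x : 'I_v) : {set 'I_v} :=
  [set y | (c^-1)%g y < (c^-1)%g x].

(** A new symbol heads its own row. For an old symbol [x] of [S], take as [T] the old symbols
    outside [S]: a row counted for [T] fails only if its new first symbol lies in [S], and the count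
    exceeds the number of such rows. *)
Lemma suitable_core_before (N v t : nat) (C : 'I_N -> 'S_v) :
  (forall (x : 'I_v) (T : {set 'I_v}), x \notin T ->
     t.+1 + #|T| <= #|[set i | before (C i) x \subset T]| + v) ->
  suitable_core t C.
Proof.
move=> many A [first [rest [inj_first _ defA]]] S cardS x xS.
have [g fg gf] := injF_bij inj_first.
case: x xS => [x|a] xS; last first.
  exists (g a) => y; rewrite !inE defA gf => /andP[ya _] /=.
  by rewrite eqxx eq_sym (negPf ya).
pose S1 := [set y : 'I_v | inl y \in S]; pose S2 := [set k : 'I_N | inr k \in S].
have cS : #|S1| + #|S2| = t.
  by rewrite -cardS -!sum1_card big_sumType /=; congr addn; apply: eq_bigl => y; rewrite inE.
have xS1 : x \notin ~: S1 by rewrite !inE xS.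
pose G := [set i | before (C i) x \subset ~: S1].
have ltSG : #|first @^-1: S2| < #|G|.
  have := many x _ xS1; have := cardsC S1; rewrite -/G card_ord.
  by rewrite card_preimset // /reverse_coercion; lia.
have [i iG iS2] : exists2 i, i \in G & i \notin first @^-1: S2.
  by apply/subsetPn/negP => /subset_leq_card; lia.
exists i => y; rewrite !inE => /andP[yx yS].
have pos z : index (inl z) (A i) = ((C i)^-1%g z).+1.
  rewrite defA /= index_cat; congr _.+1.
  have inj : injective (fun j => inl (C i j) : 'I_v + 'I_N) by move=> j k [/perm_inj].
  rewrite -[z in LHS](permKV (C i)) [in X in if X then _ else _]map_f ?mem_enum //.
  by rewrite (index_map inj) index_enum_ord.
case: y yx yS => [y|k] yx yS.
  rewrite !pos ltnS ltn_neqAle; apply/andP; split.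
    by apply: contra yx => /eqP/val_inj/perm_inj->.
  rewrite leqNgt; apply: contraL yS => lt_yx.
  by rewrite inE in iG; have := subsetP iG y; rewrite !inE => /(_ lt_yx).
rewrite pos defA /=; have -> : (inr (first i) == inr k :> 'I_v + 'I_N) = false.
  by apply/negP => /eqP[fk]; move: iS2; rewrite !inE fk yS.
rewrite index_cat ltnS; case: ifP => [/mapP[]|_] //.
by rewrite size_map size_enum_ord ltn_addr.
Qed.

Lemma perm_with_prefix (v : nat) (p : seq 'I_v) : uniq p ->
  exists c : 'S_v, forall x, x \in p ->
    before c x \subset take (index x p) p.
Proof.
move=> up; pose q := p ++ [seq x <- enum 'I_v | x \notin p].
have uq : uniq q.
  rewrite cat_uniq up filter_uniq ?enum_uniq // andbT /=.
  by apply/hasPn => x; rewrite mem_filter => /andP[].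
have sq : size q = v.
  rewrite -[RHS](card_ord v) -(card_uniqP uq); apply: eq_card => x.
  by rewrite mem_cat mem_filter mem_enum !inE andbT orbN.
have inj : injective (fun j : 'I_v => nth j q j).
  move=> i j; rewrite (set_nth_default j i) ?sq // => /eqP.
  by rewrite nth_uniq ?sq // => /eqP/val_inj.
exists (perm inj) => x xp; apply/subsetP => y; rewrite inE.
have lt_xv : index x p < v.
  apply: (@leq_trans (size q)); last by rewrite sq.
  by rewrite size_cat ltn_addr // index_mem.
have -> : (perm inj)^-1%g x = Ordinal lt_xv.
  apply: (@perm_inj _ (perm inj)); rewrite permKV permE /= nth_cat index_mem xp.
  by rewrite nth_index.
move=> lt_yx; rewrite -[y](permKV (perm inj)) permE.
set j := (perm inj)^-1%g y in lt_yx *; rewrite nth_cat.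
have lt_jp : j < size p by rewrite (ltn_trans lt_yx) // index_mem.
rewrite lt_jp; rewrite -(nth_take _ lt_yx) mem_nth // size_take.
by rewrite index_mem xp.
Qed.

(** Here [p] is only the beginning of a row, so [x] must occur in it for its predecessors to be
    known. *)
Definition preceded_within (X : finType) (x : X) (T : {set X}) (p : seq X) :=
  (x \in p) && all (mem T) (take (index x p) p).

Lemma suitable_core_prefixes (N v t : nat) (X I : finType) (f : X -> 'I_v)
    (D : {set I}) (row : I -> seq X) :
  bijective f -> #|D| <= N -> (forall i, i \in D -> uniq (row i)) ->
  (forall (x : X) (T : {set X}), x \notin T ->
     t.+1 + #|T| <= #|[set i in D | preceded_within x T (row i)]| + v) ->
  exists C : 'I_N -> 'S_v, suitable_core t C.
Proof.
move=> bij_f leDN urow many; have [g fg gf] := bij_f; have inj_f := bij_inj bij_f.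
pose L := [seq row i | i <- enum D].
(* Rows beyond the end of [L] get the empty prefix and are completed arbitrarily. *)
have uL i : uniq (map f (nth [::] L i)).
  rewrite map_inj_uniq //; case: (ltnP i (size L)) => [/(mem_nth [::])|/(nth_default [::])->//].
  by case/mapP=> d; rewrite mem_enum => /urow ud ->.
have [C defC] := fin_all_exists (fun i : 'I_N => perm_with_prefix (uL i)).
exists C; apply: suitable_core_before => x T xT.
have gxT : g x \notin f @^-1: T by rewrite inE gf.
have := many (g x) _ gxT; rewrite on_card_preimset; last exact: onW_bij.
move=> /leq_trans; apply.
rewrite leq_add2r.
set P := preceded_within _ _.
have -> : #|[set i in D | P (row i)]| = \sum_(i < size L) P (nth [::] L i).
  rewrite cardE /L.
  have -> : size (enum [set i in D | P (row i)]) = count P L.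
    rewrite count_map -size_filter /enum_mem -!filter_predI; congr size.
    by apply: eq_filter => i; rewrite /= !inE andbC.
  by rewrite -sum1_count big_mkcond (big_nth [::]) big_mkord; apply: eq_bigr => i _; case: P.
have sL : size L <= N by rewrite size_map -cardE.
rewrite (big_ord_widen _ (fun i => nat_of_bool (P (nth [::] L i))) sL) -sum1_card.
rewrite [leqRHS]big_mkcond /= [leqLHS]big_mkcond /=; apply: leq_sum => i _.
case: ifP => // _; case: (boolP (P _)) => [/andP|//][gp allT].
rewrite inE ifT //; apply/subsetP => y.
have xp : x \in map f (nth [::] L i) by rewrite -(gf x) map_f.
move/(subsetP (defC i x xp)); rewrite -{1}(gf x) index_map // -map_take.
by case/mapP => z /(allP allT) /=; rewrite inE => zT ->.
Qed.

(** * The union bound and the random colouring *)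

(** The factors of [k!] above [r ^ 2] alone contribute at least [r ^ (2 * (k - r ^ 2))]. *)
Lemma expn_lt_fact (r k : nat) : 1 < r -> 2 * r ^ 2 + 2 < k -> r ^ k.+2 < k`!.
Proof.
move=> r1 lt_k; have fact_ge B j : B ^ j <= (B + j)`!.
  elim: j => [|j IH]; first by rewrite expn0 fact_gt0.
  by rewrite expnS addnS factS leq_mul // -addnS leq_addr.
have -> : k`! = (r ^ 2 + (k - r ^ 2))`! by congr factorial; lia.
by apply: leq_trans (fact_ge _ _); rewrite -expnM ltn_exp2l //; lia.
Qed.

(** Square the claim, so that the exponents become [k * k.-1], and multiply by
    [(r - 2) ^ k * k! ^ 2]. Since ['C(n, k) * k! <= n ^ k], the [k]-th power of the first hypothesis
    bounds the left side by [r ^ 2 * r ^ (k * k)]; the surplus [r ^ k.+2] is beaten by one [k!]. *)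
Lemma union_bound (r n k : nat) : 2 < r -> n ^ 2 * (r - 2) ^ k <= r ^ k ->
  r ^ k.+2 < k`! -> r * 'C(n, k) * (r - 2) ^ 'C(k, 2) < r ^ 'C(k, 2).
Proof.
move=> r2 hn hk; have C2 : 'C(k, 2) * 2 = k * k.-1.
  by rewrite (bin_ffact k 2) ffactnS ffactn1.
rewrite -(ltn_exp2r _ _ (isT : 0 < 2)) !expnMn -!expnM C2.
have q0 : 0 < (r - 2) ^ k by rewrite expn_gt0; lia.
have f0 := fact_gt0 k.
have k0 : 0 < k by case: k hk {hn C2 q0 f0} => // ; rewrite fact0; case: r r2.
rewrite -(ltn_pmul2r q0) -(ltn_pmul2r f0) -(ltn_pmul2r f0).
have hb : 'C(n, k) ^ 2 * (k`! * k`!) <= (n ^ 2) ^ k.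
  rewrite -[k`! * _]/(k`! ^ 2) -expnMn bin_ffact -expnM mulnC expnM leq_exp2r //.
  elim: k {hn hk C2 q0 f0 k0} => // k IH.
  by rewrite ffactnSr expnSr leq_mul ?leq_subr.
have hq : (n ^ 2) ^ k * (r - 2) ^ (k * k) <= r ^ (k * k).
  by rewrite expnM -expnMn [leqRHS]expnM leq_exp2r.
have kk : k * k = k * k.-1 + k by case: k k0 {hn hk C2 q0 f0 hb hq} => // k _; rewrite -mulnSr.
have -> : r ^ 2 * 'C(n, k) ^ 2 * (r - 2) ^ (k * k.-1) * (r - 2) ^ k * k`! * k`!
   = r ^ 2 * ('C(n, k) ^ 2 * (k`! * k`!) * (r - 2) ^ (k * k)).
  by rewrite kk expnD; lia.
apply: (@leq_ltn_trans (r ^ 2 * r ^ (k * k))).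
  by rewrite leq_mul2l; apply/orP; right; apply: leq_trans hq; rewrite leq_mul2r hb orbT.
rewrite kk expnD mulnCA -expnD add2n -!mulnA ltn_pmul2l ?expn_gt0; last by lia.
by apply: (leq_trans hk); rewrite mulnA leq_pmull // muln_gt0 q0.
Qed.


(* Each pair gets a colour c, read as c in one direction and as c + 1 in the
   other, so that it misses a given colour with probability (r - 2) / r. *)
Lemma colouring_exists (n r k : nat) :
  2 < r -> r * 'C(n, k) * (r - 2) ^ 'C(k, 2) < r ^ 'C(k, 2) ->
  exists g : 'I_n -> 'I_n -> 'I_r, forall b (T : {set 'I_n}), #|T| = k ->
    exists x x', [/\ x \in T, x' \in T, x != x' & g x x' = b].
Proof.
(* All subsets are coloured, not only pairs; the colours of the others contribute equal factors to
   both sides of the count. *)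
move=> r2 ub; pose E := {set 'I_n}.
pose edges (T : {set 'I_n}) := [set A : E | A \subset T & #|A| == 2].
(* The colours of a pair that yield [b] in neither direction. *)
pose miss (b : 'I_r) : {set 'I_r} := ~: [set b; ord_pred b].
pose avoid (b : 'I_r) T : {set {ffun E -> 'I_r}} :=
  [set f : {ffun E -> 'I_r} | [forall A in edges T, f A \in miss b]].
have card_miss b : #|miss b| = r - 2.
  rewrite cardsCs setCK card_ord cards2; congr (_ - _.+1); apply/eqP.
  rewrite eqb1 -val_eqE /=; case: b => [[|b] lt_b] /=.
    by rewrite modn_small; lia.
  by rewrite modnDr modn_small; lia.
have card_avoid b (T : {set 'I_n}) : #|T| = k ->
    #|avoid b T| * r ^ 'C(k, 2) = (r - 2) ^ 'C(k, 2) * r ^ #|E|.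
  move=> cT; have cE : #|edges T| = 'C(k, 2) by rewrite cards_draws cT.
  have -> : #|avoid b T| = #|family (fun A => if A \in edges T then mem (miss b) else mem 'I_r)|.
    apply: eq_card => f; rewrite inE; apply/forall_inP/familyP => hf A.
      by case: ifP => // /hf.
    by move=> AT; have := hf A; rewrite AT.
  rewrite card_family foldrE big_map big_enum /=.
  rewrite (bigID (mem (edges T))) /=.
  under eq_bigr => A -> do rewrite card_miss.
  under [X in _ * X * _]eq_bigr => A /negPf-> do rewrite card_ord.
  rewrite !prod_nat_const cE -mulnA -expnD; congr (_ * r ^ _).
  by rewrite -cE addnC -(cardC (mem (edges T))).
have [f good] : exists f : {ffun E -> 'I_r},
    forall b (T : {set 'I_n}), #|T| = k -> f \notin avoid b T.
  pose Q (f : {ffun E -> 'I_r}) := [forall b, forall (T : {set 'I_n} | #|T| == k), f \notin avoid b T].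
  have [/existsP[f /forallP Qf]|] := boolP [exists f, Q f].
    exists f => b T /eqP cT; exact: (forall_inP (Qf b)).
  rewrite negb_exists => /forallP nQ.
  (* If every colouring were bad, the sets [avoid b T] would cover them all. *)
  have : #|{ffun E -> 'I_r}| <= \sum_(b : 'I_r) \sum_(T : {set 'I_n} | #|T| == k) #|avoid b T|.
    under eq_bigr => b _ do under eq_bigr => T _ do rewrite -sum1_card big_mkcond.
    under eq_bigr => b _ do rewrite exchange_big /=.
    rewrite exchange_big /= -sum1_card; apply: leq_sum => f _.
    have := nQ f; rewrite negb_forall => /existsP[b]; rewrite negb_forall_in.
    case/exists_inP=> T cT /negbNE fT.
    by rewrite (bigD1 b) //= (bigD1 T) //= fT -addnA leq_addr.
  have r0 : 0 < r ^ 'C(k, 2) by rewrite expn_gt0; lia.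
  rewrite -(leq_pmul2r r0) big_distrl.
  under eq_bigr => b _.
    rewrite big_distrl /=; under eq_bigr => T /eqP cT do rewrite card_avoid //.
    rewrite sum_nat_const.
    have -> : #|[pred T : {set 'I_n} | #|T| == k]| = 'C(n, k).
      rewrite -[n in RHS]card_ord -cardsT -cards_draws; apply: eq_card => A; rewrite !inE subsetT //.
    over.
  rewrite sum_nat_const card_ord card_ffun card_ord !mulnA mulnC leq_pmul2r ?expn_gt0; last by lia.
  by rewrite leqNgt ub.
exists (fun x x' : 'I_n => if x < x' then f [set x; x'] else ordS (f [set x; x'])) => b T cT.
have := good b T cT; rewrite inE negb_forall_in => /exists_inP[A].
rewrite inE => /andP[AT /cards2P[x [x' [nx defA]]]].
have [xT x'T] : x \in T /\ x' \in T by split; apply: (subsetP AT); rewrite defA !inE eqxx ?orbT.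
rewrite {A AT}defA; wlog ltx : x x' nx xT x'T / x < x'.
  move=> IH; have := nx; rewrite neq_ltn => /orP[|] ltx; first exact: IH ltx.
  by rewrite setUC; apply: IH => //; rewrite eq_sym.
rewrite !inE negbK => /orP[] /eqP fb.
  by exists x, x'; rewrite ltx.
exists x', x; rewrite ltnNge (ltnW ltx) /= setUC fb ord_predK; split=> //.
by rewrite eq_sym.
Qed.

(** * Construction of the core from a colouring *)

(** While more than [e] points remain, some pair has colour [b]; deleting its first point destroys
    that pair, so each deletion accounts for a new one. *)
Lemma card_coloured_pairs (X B : finType) (g : X -> X -> B) (b : B) (e : nat) :
  (forall T : {set X}, #|T| = e.+1 ->
     exists x x', [/\ x \in T, x' \in T, x != x' & g x x' = b]) ->
  forall T : {set X}, #|T| <= e +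
    #|[set p : X * X | [&& p.1 \in T, p.2 \in T, p.1 != p.2 & g p.1 p.2 == b]]|.
Proof.
move=> dense T; have [j] := ubnP #|T|; elim: j T => // j IH T.
have [|lt_eT] := leqP #|T| e; first by move=> leTe _; rewrite (leq_trans leTe) ?leq_addr.
have [T' sT'T cT'] : exists2 T' : {set X}, T' \subset T & #|T'| = e.+1.
  exists [set x in take e.+1 (enum T)].
    by apply/subsetP => x; rewrite inE => /mem_take; rewrite mem_enum.
  rewrite cardsE (card_uniqP _) ?take_uniq ?enum_uniq // size_take -cardE.
  by move: lt_eT; rewrite leq_eqVlt => /orP[/eqP<-|->] //; rewrite ltnn.
have [x [x' [xT' x'T' nx gb]]] := dense T' cT'.
have [xT x'T] := (subsetP sT'T x xT', subsetP sT'T x' x'T').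
rewrite (cardsD1 x T) xT add1n ltnS => /IH{}IH.
rewrite [X in _ + X](cardsD1 (x, x')) inE /= xT x'T nx gb eqxx add1n addnS ltnS.
apply: leq_trans IH _; rewrite leq_add2l subset_leq_card //.
apply/subsetP => -[y y']; rewrite !inE /= => /and4P[/andP[yx ->] /andP[_ ->] -> ->].
by rewrite -pair_eqE /= (negPf yx).
Qed.

(** Each colour [b] starts [n + r + d] rows. The index [z = inr b], which cannot give a second
    symbol, serves as one more spare row. *)
Definition core_row (n r d : nat) (g : 'I_n -> 'I_n -> 'I_r)
    (i : 'I_n * 'I_n + 'I_r * ('I_n + 'I_r + 'I_d)) : seq ('I_n + 'I_r) :=
  match i with
  | inl (x, x') => [:: inl x; inl x'; inr (g x x')]
  | inr (b, inl z) => if z == inr b then [:: inr b] else [:: inr b; z]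
  | inr (b, inr _) => [:: inr b]
  end.

(** The demand is [n.-1 + #|T|] rows. A point gets [n.-1] rows as first symbol and one as second
    symbol for each element of [T]. A colour gets [n + r + d] rows as first symbol, one for each
    colour in [T], and, as third symbol, at least the number of points in [T] minus [(r + d).+1]. *)
Lemma suitable_core_colouring (n r d N t : nat) (g : 'I_n -> 'I_n -> 'I_r) :
  0 < n -> t = n.-1 + (n + r).-1 ->
  n * n.-1 + r * (n + r + d) <= N ->
  (forall b (T : {set 'I_n}), #|T| = (r + d).+2 ->
    exists x x', [/\ x \in T, x' \in T, x != x' & g x x' = b]) ->
  exists C : 'I_N -> 'S_(n + r), suitable_core t C.
Proof.
move=> n0 deft leN dense.
pose I := ('I_n * 'I_n + 'I_r * ('I_n + 'I_r + 'I_d))%type.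
pose D : {set I} := [set i | if i is inl p then p.1 != p.2 else true].
have bij : bijective (@unsplit n r) by exists (@split n r); [exact: unsplitK|exact: splitK].
apply: (@suitable_core_prefixes _ _ _ _ I _ D (core_row g) bij).
- apply: leq_trans leN; rewrite -sum1_card big_sumType /=; apply: leq_add.
    rewrite sum1dep_card.
    have -> : [set x : 'I_n * 'I_n | inl x \in D] = ~: [set (x, x) | x : 'I_n].
      apply/setP=> -[x x']; rewrite !inE; congr negb.
      apply/eqP/imsetP => /= [<-|[y _ [-> ->]] //]; by exists x.
    rewrite cardsCs setCK card_imset; last by move=> x y [].
    by rewrite card_prod card_ord; nia.
  rewrite sum1dep_card (leq_trans (max_card _)) // card_prod !card_sum !card_ord //.
- case=> [[x x']|[b [z|c]]] //; rewrite inE /= ?inE.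
    by move=> nx; rewrite andbT orbF; apply: contra nx => /eqP[->].
  by move=> _; case: ifP => //= nz; rewrite inE eq_sym nz.
move=> x T xT; pose T1 := [set y | inl y \in T]; pose T2 := [set b | inr b \in T].
have cT : #|T| = #|T1| + #|T2|.
  by rewrite -!sum1_card big_sumType /=; congr addn; apply: eq_bigl => y; rewrite inE.
set G := [set i in D | _].
pose G1 := [set p | inl p \in G]; pose G2 := [set q | inr q \in G].
have cG : #|G| = #|G1| + #|G2|.
  by rewrite -!sum1_card big_sumType /=; congr addn; apply: eq_bigl => y; rewrite [RHS]inE.
rewrite cT cG {cT cG}; case: x xT @G @G1 @G2 => [a|b] xT G G1 G2.
- have le1 : n.-1 + #|T1| <= #|G1|.
    pose A := [set (a, x) | x in [set~ a]]; pose B := [set (x, a) | x in T1].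
    have <- : #|A :|: B| = n.-1 + #|T1|.
      rewrite cardsU !card_imset; try by move=> ? ? [].
      rewrite cardsC1 card_ord (_ : A :&: B = set0) ?cards0 ?subn0 //.
      apply/setP=> p; rewrite !inE; apply/negP => /andP[/imsetP[y ya ->] /imsetP[z zT [az _]]].
      by move: zT xT; rewrite -az inE => ->.
    apply/subset_leq_card/subsetP => p; rewrite !inE => /orP[] /imsetP[y]; rewrite !inE => yP -> /=.
      by rewrite eq_sym yP /preceded_within /= inE eqxx.
    have ya : y != a by apply: contraNneq xT => <-.
    by rewrite ya /preceded_within /= !inE !eqxx orbT /= (_ : (inl y == inl a) = (y == a)) // (negPf ya) /= andbT yP.
  have le2 : #|T2| <= #|G2|.
    rewrite -(@card_imset _ _ (fun b => (b, inl (inl a) : 'I_n + 'I_r + 'I_d))); last by move=> ? ? [].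
    apply/subset_leq_card/subsetP => q /imsetP[b]; rewrite !inE => bT -> /=.
    by rewrite /preceded_within /= !inE eqxx /= bT.
  by rewrite deft; lia.
- have le1 : #|T1| <= (r + d).+1 + #|G1|.
    apply: leq_trans (card_coloured_pairs (dense b) T1) _; rewrite leq_add2l.
    apply/subset_leq_card/subsetP => -[y y']; rewrite !inE /= => /and4P[yT y'T -> /eqP gb].
    by rewrite /preceded_within /= gb !inE !eqxx /= yT y'T.
  have le2 : n + r + d + #|T2| <= #|G2|.
    pose A := [set (b, z) | z : 'I_n + 'I_r + 'I_d].
    pose B := [set (c, inl (inr b) : 'I_n + 'I_r + 'I_d) | c in T2].
    have <- : #|A :|: B| = n + r + d + #|T2|.
      rewrite cardsU !card_imset; try by move=> ? ? [].
      rewrite !card_sum !card_ord (_ : A :&: B = set0) ?cards0 ?subn0 //.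
      apply/setP=> p; rewrite !inE; apply/negP => /andP[/imsetP[y ya ->] /imsetP[z zT [az _]]].
      by move: zT xT; rewrite -az inE => ->.
    apply/subset_leq_card/subsetP => p; rewrite !inE => /orP[] /imsetP[y].
      move=> _ -> /=; case: y => [z|?]; last by rewrite /preceded_within /= inE eqxx.
      by case: ifP; rewrite /preceded_within /= inE eqxx.
    rewrite inE => yT -> /=.
    have yb : y != b by apply: contraNneq xT => <-.
    have nby : (inr b == inr y :> 'I_n + 'I_r) = (b == y) by [].
    have nyb : (inr y == inr b :> 'I_n + 'I_r) = (y == b) by [].
    rewrite nby eq_sym (negPf yb) /preceded_within /= !inE nby nyb (negPf yb) eqxx orbT /= andbT.
    by [].
  by rewrite deft; lia.
Qed.

Lemma suitable_core_union_bound (n r m t : nat) (e := m %/ r) :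
  0 < n -> 2 < r < e -> t = n.-1 + (n + r).-1 ->
  r * 'C(n, e.+1) * (r - 2) ^ 'C(e.+1, 2) < r ^ 'C(e.+1, 2) ->
  exists C : 'I_((n + r) * n.-1 + m) -> 'S_(n + r), suitable_core t C.
Proof.
move=> n0 /andP[r2 lt_re] deft /(colouring_exists r2)[g dense].
(* With [d = e - r.+1] each colour starts [n.-1 + e] rows, and [r * e <= m] keeps the total within
   [N]. *)
have defe : e.+1 = (r + (e - r.+1)).+2 by clear -lt_re; lia.
rewrite {}defe in dense; apply: suitable_core_colouring dense => //.
have -> : n + r + (e - r.+1) = n.-1 + e by clear -n0 lt_re; lia.
by rewrite mulnDr mulnDl -addnA !leq_add2l mulnC leq_divM.
Qed.

(** * Logarithmic estimates and the choice of parameters *)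

Local Open Scope ring_scope.

Lemma ln_ratio_gt0 (R : realType) (r : nat) : (2 < r)%N ->
  0 < ln (r%:R : R) - ln (r%:R - 2 : R).
Proof.
move=> r2; have r2R : (2 : R) < r%:R by rewrite ltr_nat.
by rewrite subr_gt0 ltr_ln ?posrE; lra.
Qed.

Lemma sqr_exp_ratio_le (R : realType) (r n k : nat) (u : R) :
  (2 < r)%N -> 2 * u <= k%:R * (ln (r%:R : R) - ln (r%:R - 2 : R)) ->
  (0 < n)%N -> ln (n%:R : R) <= u ->
  (n ^ 2 * (r - 2) ^ k <= r ^ k)%N.
Proof.
move=> r2 hk n0 hn; have r2R : (2 : R) < r%:R by rewrite ltr_nat.
have n0R : (0 : R) < n%:R by rewrite ltr0n.
have q0 : 0 < r%:R - 2 :> R by lra.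
have q1 : 0 < r%:R :> R by lra.
rewrite -(@ler_nat R) natrM !natrX natrB; last by lia.
rewrite -ler_ln ?posrE ?mulr_gt0 ?exprn_gt0 // lnM ?posrE ?exprn_gt0 // !lnXn //.
move: hk; rewrite [k%:R * _]mulr_natl mulrnBl -lerBrDr; apply: le_trans.
by rewrite mulr_natl lerMn2r hn.
Qed.

Lemma ln_nat_unbounded (R : realType) (a : R) :
  exists s0 : nat, forall s : nat, (s0 <= s)%N -> a <= ln (s%:R : R).
Proof.
exists (Num.truncn (expR a)).+1 => s hs.
have h : expR a < s%:R by rewrite (lt_le_trans (truncnS_gt _)) // ler_nat.
by rewrite -[a]expRK ler_ln ?posrE ?expR_gt0 ?(ltW h) // (lt_trans _ h) ?expR_gt0.
Qed.

(** For the integer meant by [tau * ln s], any [m] at distance less than 1 is allowed, which covers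
    rounding down and up. *)
Theorem theorem5 (R : realType) (alpha delta r : nat) (tau : R)
    (hdelta : delta = 0%N \/ delta = 1%N)
    (halpha : (3 <= alpha)%N)
    (hr : r = (2 * alpha - delta - 2)%N)
    (htau : 2 * r%:R / (ln (r%:R : R) - ln (r%:R - 2 : R)) <= tau) :
  exists s0 : nat, forall s : nat, (s0 <= s)%N ->
    let t := (2 * s + delta)%N in
    let v := (s + alpha)%N in
    forall m : nat, `|m%:R - tau * ln (s%:R : R)| < 1 ->
      let N := (v * (t + 1 - v) + m)%N in
      exists C : 'I_N -> 'S_v, suitable_core t C.
Proof.
have r2 : (2 < r)%N by clear -hdelta halpha hr; case: hdelta; lia.
have L0 := @ln_ratio_gt0 R _ r2; set L := _ - _ in L0 htau.
have r0 : 0 < r%:R :> R by rewrite ltr0n (ltn_trans _ r2).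
have tau0 : 0 < tau by apply: lt_le_trans htau; rewrite divr_gt0 // mulr_gt0.
(* Large enough that [e >= K] gives both [r < e] and the hypothesis of [expn_lt_fact] for [e.+1]. *)
pose K := (2 * r ^ 2 + r + 3)%N.
have [s0 hs0] := @ln_nat_unbounded R ((K * r)%:R / tau).
(* This is [n = t + 2 - v]; the summand [alpha] in the threshold keeps the subtraction exact, and
   [delta + 2 <= 3 <= alpha] gives [n <= s]. *)
exists (s0 + alpha)%N => s hs t v m hm N; pose n := (s + delta + 2 - alpha)%N.
have [n0 le_ns] : (0 < n)%N /\ (n <= s)%N.
  by clear -hs hdelta halpha; rewrite /n; case: hdelta => ->; lia.
have defv : v = (n + r)%N.
  by clear -hs hdelta halpha hr; rewrite /v /n hr; case: hdelta => ->; lia.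
have deft : t = (n.-1 + v.-1)%N.
  by clear -hs halpha; rewrite /t /v /n; lia.
have hm1 : tau * ln (s%:R : R) < m.+1%:R.
  by rewrite -natr1; move: hm; clear; rewrite ltr_norml => /andP[]; lra.
pose e := (m %/ r)%N.
have leKe : (K <= e)%N.
  rewrite leq_divRL ?(ltn_trans _ r2) // -ltnS -(ltr_nat R).
  apply: le_lt_trans hm1; rewrite -ler_pdivrMl // mulrC; apply: hs0.
  exact: leq_trans (leq_addr _ _) hs.
have ratio : (n ^ 2 * (r - 2) ^ e.+1 <= r ^ e.+1)%N.
  apply: (@sqr_exp_ratio_le R _ _ _ (ln s%:R)) => //; last first.
    by rewrite ler_ln ?posrE ?ltr0n ?ler_nat // (leq_trans n0).
  have ln_s0 : 0 <= ln (s%:R : R) by rewrite ln_ge0 // ler1n (leq_trans n0).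
  (* The bound on [tau] enters here, through [tau * ln s < m + 1 <= r * (e + 1)]. *)
  have key : 2 * r%:R * ln s%:R <= (r * e.+1)%:R * L.
    rewrite -ler_pdivrMr // mulrAC; apply: (@le_trans _ _ (tau * ln s%:R)).
      by rewrite ler_wpM2r.
    by rewrite (le_trans (ltW hm1)) // ler_nat mulnC ltn_ceil // (ltn_trans _ r2).
  by rewrite -(ler_pM2l r0) !mulrA [_ * 2]mulrC; rewrite natrM in key.
have lt_fact : (r ^ e.+3 < e.+1`!)%N.
  by apply: expn_lt_fact; [exact: ltnW | clear -leKe; lia].
have -> : N = (v * n.-1 + m)%N.
  by rewrite /N; congr (_ * _ + _)%N; clear -deft n0 hs; rewrite deft /v /n; lia.
rewrite defv in deft *; apply: suitable_core_union_bound => //.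
  by rewrite r2; clear -leKe; lia.
exact: union_bound.
Qed.
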